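(* Let $\mathfrak l$ be an abelian Lie algebra, $(\mathfrak a,[\cdot,\cdot]_{\mathfrak a},\omega_{\mathfrak a})$ a symplectic Lie algebra and $(\gamma,\epsilon,\xi)\in Z^2(\mathfrak l,\mathfrak a,\omega_{\mathfrak a})$. The quadratic extension $\mathfrak d_{\gamma,\epsilon,\xi}(\mathfrak l,\mathfrak a)$ is balanced if and only if $(\gamma,\epsilon,\xi)\in Z^2(\mathfrak l,\mathfrak a,\omega_{\mathfrak a})_\sharp$.
   Context: All vector spaces and Lie algebras are real and finite-dimensional. A symplectic Lie algebra $(\mathfrak g,\omega)$ is a Lie algebra $\mathfrak g$ with a skew-symmetric non-degenerate bilinear form $\omega$ such that $\omega([X,Y],Z)+\omega([Y,Z],X)+\omega([Z,X],Y)=0$ for all $X,Y,Z$. An isomorphism of symplectic Lie algebras is a Lie algebra isomorphism $\varphi$ with $\varphi^*\omega_2=\omega_1$. Orthogonal complements ${}^\perp$ are with respect to $\omega$. A quadratic extension of an abelian Lie algebra $\mathfrak l$ by a symplectic Lie algebra $(\mathfrak a,\omega_{\mathfrak a})$ is a tuple $(\mathfrak g,\mathfrak j,i,p)$, where $(\mathfrak g,\omega_{\mathfrak g})$ is a symplectic Lie algebra with center $\mathfrak z$, $\mathfrak j\subset\mathfrak z$ is an isotropic ideal of $\mathfrak g$, and $i,p$ are Lie algebra homomorphisms forming a short exact sequence $0\to\mathfrak a\xrightarrow{i}\mathfrak g/\mathfrak j\xrightarrow{p}\mathfrak l\to0$ such that $\operatorname{im} i=\mathfrak j^\perp/\mathfrak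 j$ and $i:\mathfrak a\to\mathfrak j^\perp/\mathfrak j$ is an isomorphism of symplectic Lie algebras (for the induced form). It is balanced if $\mathfrak j=\mathfrak z\cap\mathfrak z^\perp$. Let $\gamma:\mathfrak l\to\operatorname{Hom}(\mathfrak a,\mathfrak l^* )$ and $\xi:\mathfrak l\to\operatorname{Hom}(\mathfrak a,\mathfrak a)$ be linear and $\epsilon:\mathfrak l\times\mathfrak l\to\mathfrak l^*$ alternating bilinear. Write $\gamma(L_1,A,L_2):=(\gamma(L_1)(A))(L_2)$. Define alternating bilinear maps $\alpha:\mathfrak l\times\mathfrak l\to\mathfrak a$, $\beta:\mathfrak a\times\mathfrak a\to\mathfrak l^*$ by $$\omega_{\mathfrak a}(\alpha(L_1,L_2),A)=\gamma(L_1,A,L_2)-\gamma(L_2,A,L_1),\qquad \beta(A_1,A_2)(L)=-\omega_{\mathfrak a}(\xi(L)A_1,A_2)-\omega_{\mathfrak a}(A_1,\xi(L)A_2).$$ $Z^2(\mathfrak l,\mathfrak a,\omega_{\mathfrak a})$ is the set of such triples with, for all $L,L_i\in\mathfrak l$, $A,A_i\in\mathfrak a$: (1) every $\xi(L)$ is a derivation of $\mathfrak a$, $\xi(L_1)\xi(L_2)-\xi(L_2)\xi(L_1)=\operatorname{ad}_{\mathfrak a}(\alpha(L_1,L_2))$, and $\xi(L_1)\alpha(L_2,L_3)+\xi(L_2)\alpha(L_3,L_1)+\xi(L_3)\alpha(L_1,L_2)=0$; (2) $\beta(\xi(L)A_1,A_2)+\beta(A_1,\xi(L)A_2)=\gamma(L)[A_1,A_2]_{\mathfrak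 a}$; (3) $\gamma(L_2)(\xi(L_1)A)-\gamma(L_1)(\xi(L_2)A)+\beta(\alpha(L_1,L_2),A)=0$; (4) $\gamma(L_1)\alpha(L_2,L_3)+\gamma(L_2)\alpha(L_3,L_1)+\gamma(L_3)\alpha(L_1,L_2)=0$; (5) $\epsilon(L_1,L_2)L_3+\epsilon(L_2,L_3)L_1+\epsilon(L_3,L_1)L_2=0$. For $(\gamma,\epsilon,\xi)\in Z^2(\mathfrak l,\mathfrak a,\omega_{\mathfrak a})$, $\mathfrak d_{\gamma,\epsilon,\xi}(\mathfrak l,\mathfrak a)$ is the symplectic Lie algebra $\mathfrak l^*\oplus\mathfrak a\oplus\mathfrak l$ with brackets $[\mathfrak l^*,\cdot]=0$, $[A_1,A_2]=\beta(A_1,A_2)+[A_1,A_2]_{\mathfrak a}$, $[L,A]=\gamma(L)A+\xi(L)A$, $[L_1,L_2]=\epsilon(L_1,L_2)+\alpha(L_1,L_2)$ and form $\omega(Z_1+A_1+L_1,Z_2+A_2+L_2)=Z_1(L_2)+\omega_{\mathfrak a}(A_1,A_2)-Z_2(L_1)$. The same symbol denotes the quadratic extension $(\mathfrak d_{\gamma,\epsilon,\xi}(\mathfrak l,\mathfrak a),\mathfrak l^*,i,p)$ of $\mathfrak l$ by $\mathfrak a$, where $\mathfrak d_{\gamma,\epsilon,\xi}(\mathfrak l,\mathfrak a)/\mathfrak l^*$ is identified with $\mathfrak a\oplus\mathfrak l$ and $i,p$ are the canonical embedding and projection. $Z^2(\mathfrak l,\mathfrak a,\omega_{\mathfrak a})_\sharp$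 is the set of $(\gamma,\epsilon,\xi)\in Z^2(\mathfrak l,\mathfrak a,\omega_{\mathfrak a})$ (called balanced cocycles) such that (a) $L=0$ is the only $L\in\mathfrak l$ for which there is an $A\in\mathfrak a$ satisfying simultaneously $\operatorname{ad}_{\mathfrak a}(A)+\xi(L)=0$, $\gamma(L)+\beta(A,\cdot)=0$, $\alpha(L,L')=\xi(L')A$ and $\epsilon(L,L')=\gamma(L')A$ for all $L'\in\mathfrak l$; (b) the subspace $\{A\in\mathfrak z(\mathfrak a): \beta(A,\cdot)=0,\ \xi(L)A=0,\ \gamma(L)A=0\ \forall L\in\mathfrak l\}$ of $\mathfrak a$ is non-degenerate with respect to $\omega_{\mathfrak a}$ (the zero subspace counts as non-degenerate). *)

(* Defs.v *)
From HB Require Import structures.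
From mathcomp Require Import all_boot all_order all_algebra.
From mathcomp Require Import ring.

Set Implicit Arguments.
Unset Strict Implicit.
Unset Printing Implicit Defensive.

Import GRing.Theory VectorInternalTheory.
Local Open Scope ring_scope.
Local Open Scope quotient_scope.

HB.mixin Record isLieAlgebra (K : fieldType) (V : Type) of Vector K V := {
  lie : {bilinear V -> V -> V};
  liexx : forall x : V, lie x x = 0;
  lie_jacobi : forall x y z : V,
    lie x (lie y z) + lie y (lie z x) + lie z (lie x y) = 0
}.

#[short(type="lieAlgType")]
HB.structure Definition LieAlgebra (K : fieldType) :=
  {V of isLieAlgebra K V & Vector K V}.

Definition lie_abelian (K : fieldType) (g : lieAlgType K) : Prop :=
  forall x y : g, lie x y = 0.

Definition lie_morphism (K : fieldType) (g h : lieAlgType K)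
  (f : 'Hom(g, h)) : Prop := forall x y : g, f (lie x y) = lie (f x) (f y).

Definition lie_derivation (K : fieldType) (g : lieAlgType K)
  (D : 'End(g)) : Prop :=
  forall x y : g, D (lie x y) = lie (D x) y + lie x (D y).

Record symplLieAlg (K : fieldType) := SymplLieAlg {
  sympl_alg :> lieAlgType K;
  omega : {skew_symmetric sympl_alg};
  omega_nondegenerate : nondegenerate omega;
  omega_closed : forall x y z : sympl_alg,
    omega (lie x y) z + omega (lie y z) x + omega (lie z x) y = 0
}.
Arguments omega {K s}.

Section Center.
Variables (K : fieldType) (g : lieAlgType K).

Definition lie_center : {vspace g} :=
  lker (linfun (fun x : g => linfun (lie x) : 'End(g))).

Fact ad_is_linear : linear (fun x : g => linfun (lie x) : 'End(g)).
Proof.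
move=> k x y; apply/lfunP => z.
by rewrite add_lfunE scale_lfunE !lfunE /= linearPl.
Qed.

Lemma lie_centerP (x : g) : reflect (forall y, lie x y = 0) (x \in lie_center).
Proof.
pose adL := GRing.isLinear.Build _ _ _ _ _ ad_is_linear.
pose ad : {linear g -> 'End(g)} := HB.pack (fun x : g => linfun (lie x)) adL.
have adE z : linfun ad z = linfun (lie z) by rewrite lfunE.
rewrite memv_ker -[X in linfun X]/(ad : g -> _) adE.
apply: (iffP eqP) => [h y|h].
  by rewrite -[LHS](lfunE (lie x)) h lfunE.
by apply/lfunP => y; rewrite !lfunE /= h.
Qed.

End Center.
Arguments lie_center {K} g.

Section QuotientSpace.
Variables (K : fieldType) (V : vectType K) (U : {vspace V}).

Definition quotv : Type := Quotient.quot (pred_of_vspace U).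
HB.instance Definition _ := GRing.Zmodule.on quotv.
HB.instance Definition _ := EqQuotient.on quotv.

Definition quot_pi (x : V) : quotv := \pi x.

Lemma quot_piE x y : (quot_pi x == quot_pi y) = (x - y \in U).
Proof. by rewrite [RHS]Quotient.idealrBE. Qed.

Lemma quot_piD : {morph quot_pi : x y / x + y}.
Proof. by move=> x y; apply: pi_addr. Qed.

Lemma repr_quotK (q : quotv) : quot_pi (repr q) = q.
Proof. exact: reprK. Qed.

Definition quot_scale (k : K) (q : quotv) : quotv := quot_pi (k *: repr q).

Lemma quot_piZ k x : quot_pi (k *: x) = quot_scale k (quot_pi x).
Proof.
by apply/eqP; rewrite quot_piE -scalerBr rpredZ // -quot_piE repr_quotK.
Qed.

Fact quot_scaleA j k (q : quotv) :
  quot_scale j (quot_scale k q) = quot_scale (j * k) q.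
Proof. by rewrite -[q]repr_quotK -!quot_piZ scalerA. Qed.
Fact quot_scale1 : left_id 1 quot_scale.
Proof. by move=> q; rewrite -[q]repr_quotK -!quot_piZ scale1r. Qed.
Fact quot_scaleDr : right_distributive quot_scale +%R.
Proof.
move=> k q r; rewrite -[q]repr_quotK -[r]repr_quotK.
by rewrite -!(quot_piZ, quot_piD) scalerDr.
Qed.
Fact quot_scaleDl q : {morph quot_scale^~ q : j k / j + k}.
Proof.
by move=> j k /=; rewrite -[q]repr_quotK -!(quot_piZ, quot_piD) scalerDl.
Qed.
HB.instance Definition _ := GRing.Zmodule_isLmodule.Build K quotv
  quot_scaleA quot_scale1 quot_scaleDr quot_scaleDl.

Fact quot_pi_is_linear : linear quot_pi.
Proof. by move=> k x y; rewrite quot_piD quot_piZ. Qed.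
HB.instance Definition _ :=
  GRing.isLinear.Build K V quotv _ quot_pi quot_pi_is_linear.

Fact quotv_axiom : Vector.axiom (dim (subvs_of U^C)) quotv.
Proof.
pose f (x : V) : subvs_of U^C := vsproj U^C (daddv_pi U^C U x).
have dUC : (U^C :&: U = 0)%VS by rewrite capvC capv_compl.
have fU x : x \in U -> f x = 0.
  move=> xU; rewrite /f; have := @daddv_pi_add _ _ U^C U x dUC.
  rewrite addvC addv_complf memvf [daddv_pi U _ _]daddv_pi_id //; last first.
    by rewrite capvC.
  by move=> /(_ isT)/(canRL (addrK _)) ->; rewrite subrr linear0.
have fpi x : f (repr (quot_pi x)) = f x.
  apply/eqP; rewrite -subr_eq0 /f -!linearB /=; apply/eqP/fU.
  by rewrite -quot_piE repr_quotK.
pose h (q : quotv) := v2r (f (repr q)).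
pose h' r : quotv := quot_pi (vsval (r2v r : subvs_of U^C)).
exists h.
  move=> k q r; rewrite -[q]repr_quotK -[r]repr_quotK -linearP /h !fpi.
  by rewrite /f !linearP.
exists h'.
  move=> q; rewrite /h /h' v2rK -[q in RHS]repr_quotK.
  apply/eqP; rewrite eq_sym quot_piE /f vsprojK ?memv_pi //.
  have := @daddv_pi_add _ _ U^C U (repr q) dUC.
  rewrite addvC addv_complf memvf => /(_ isT) e.
  by rewrite -[X in X - _]e addrAC subrr add0r memv_pi.
move=> r; rewrite /h /h' fpi /f daddv_pi_id ?subvsP //.
by rewrite vsvalK r2vK.
Qed.
HB.instance Definition _ := Lmodule_hasFinDim.Build K quotv quotv_axiom.

End QuotientSpace.

Record lieIdeal (K : fieldType) (g : lieAlgType K) := LieIdeal {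
  ideal_space :> {vspace g};
  idealP : forall x y : g, y \in ideal_space -> lie x y \in ideal_space
}.

Section QuotientLie.
Variables (K : fieldType) (g : lieAlgType K) (j : lieIdeal g).

Lemma lieC (x y : g) : lie x y = - lie y x.
Proof.
apply/eqP; rewrite -addr_eq0; have := liexx (x + y).
by rewrite !(linearDl, linearDr) /= !liexx addr0 add0r => ->.
Qed.

Definition lie_quot : Type := quotv j.
HB.instance Definition _ := Vector.on lie_quot.

Definition quot_lie (q r : lie_quot) : lie_quot :=
  quot_pi j (lie (repr q) (repr r)).

Lemma quot_lieE x y :
  quot_lie (quot_pi j x) (quot_pi j y) = quot_pi j (lie x y).
Proof.
have piE z : repr (quot_pi j z) - z \in ideal_space j.
  by rewrite -quot_piE repr_quotK.
apply/eqP; rewrite quot_piE.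
set x' := repr _; set y' := repr _.
have -> : lie x' y' - lie x y = lie x' (y' - y) - lie y (x' - x).
  rewrite !linearBr /= [lie y x']lieC [lie y x]lieC opprB opprK.
  by rewrite [- _ + lie x' y]addrC addrA subrK.
by rewrite rpredB ?idealP ?piE //; apply: piE.
Qed.

Fact quot_lie_bilinear : bilinear_for *:%R *:%R quot_lie.
Proof.
split=> r k p q; rewrite -[r]repr_quotK -[p]repr_quotK -[q]repr_quotK.
  by rewrite -linearP !quot_lieE linearPl linearP.
by rewrite -linearP !quot_lieE linearPr linearP.
Qed.
HB.instance Definition _ := bilinear_isBilinear.Build K lie_quot lie_quot
  lie_quot *:%R *:%R quot_lie quot_lie_bilinear.

Fact quot_liexx q : quot_lie q q = 0.
Proof. by rewrite -[q]repr_quotK quot_lieE liexx linear0. Qed.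
Fact quot_lie_jacobi p q r :
  quot_lie p (quot_lie q r) + quot_lie q (quot_lie r p)
  + quot_lie r (quot_lie p q) = 0.
Proof.
rewrite -[p]repr_quotK -[q]repr_quotK -[r]repr_quotK !quot_lieE -!linearD.
by rewrite lie_jacobi linear0.
Qed.
HB.instance Definition _ := isLieAlgebra.Build K lie_quot
  quot_liexx quot_lie_jacobi.

Definition lie_pi : 'Hom(g, lie_quot) := linfun (quot_pi j).

Lemma lie_piE x : lie_pi x = quot_pi j x.
Proof. exact: lfunE. Qed.

End QuotientLie.

(* [qext_i] is valued in g/j; that it is an isomorphism onto j^⊥/j with its
   induced form is expressed by injectivity, [qext_image] and [qext_form]. *)
Record quadExt (K : fieldType) (l : lieAlgType K) (a : symplLieAlg K) :=
  QuadExt {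
  qext_alg : symplLieAlg K;
  qext_j : lieIdeal qext_alg;
  qext_i : 'Hom(a, lie_quot qext_j);
  qext_p : 'Hom(lie_quot qext_j, l);
  qext_abelian : lie_abelian l;
  qext_central : (qext_j <= lie_center qext_alg)%VS;
  qext_isotropic : (qext_j <= orthov omega qext_j)%VS;
  qext_i_morph : lie_morphism qext_i;
  qext_p_morph : lie_morphism qext_p;
  qext_exact_a : lker qext_i = 0%VS;
  qext_exact_mid : limg qext_i = lker qext_p;
  qext_exact_l : limg qext_p = fullv;
  qext_image : limg qext_i = (lie_pi qext_j @: orthov omega qext_j)%VS;
  qext_form : forall (A B : a) (x y : qext_alg),
    lie_pi qext_j x = qext_i A -> lie_pi qext_j y = qext_i B ->
    omega x y = omega A B
}.

Definition balanced (K : fieldType) (l : lieAlgType K) (a : symplLieAlg K)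
  (E : quadExt l a) : Prop :=
  ideal_space (qext_j E)
  = (lie_center (qext_alg E) :&: orthov omega (lie_center (qext_alg E)))%VS.

Definition dual (K : fieldType) (V : vectType K) := 'Hom(V, K^o).

Lemma linfun_linearE (K : fieldType) (V W : vectType K) (f : V -> W) :
  linear f -> linfun f =1 f.
Proof.
move=> lf; pose fL := GRing.isLinear.Build _ _ _ _ f lf.
by pose g : {linear V -> W} := HB.pack f fL; apply: (lfunE g).
Qed.

Lemma scale_regE (K : fieldType) (k : K) (x : K^o) : k *: x = k * x :> K.
Proof. by []. Qed.

Section DualE.
Variables (K : fieldType) (V : vectType K).
Implicit Types f g : dual V.
Lemma dualP f k x y : f (k *: x + y) = k * f x + f y :> K.
Proof. by rewrite linearP. Qed.
Lemma dualD f g x : (f + g) x = f x + g x :> K.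
Proof. by rewrite add_lfunE. Qed.
Lemma dualN f x : (- f) x = - f x :> K.
Proof. by rewrite opp_lfunE. Qed.
Lemma dualZ k f x : (k *: f) x = k * f x :> K.
Proof. by rewrite scale_lfunE. Qed.
Lemma dual0 x : (0 : dual V) x = 0 :> K.
Proof. by rewrite zero_lfunE. Qed.
Definition dualE := (dualP, dualD, dualN, dualZ, dual0).
End DualE.

Section Musical.
Variables (K : fieldType) (a : symplLieAlg K).

Lemma omegaC (x y : a) : omega x y = - omega y x.
Proof. by rewrite hermC /= expr1 mulN1r. Qed.

Lemma omega_inj (x y : a) : (forall z, omega x z = omega y z) -> x = y.
Proof.
move=> h; apply/eqP; rewrite -subr_eq0 -memv0.
rewrite -(eqP (omega_nondegenerate a)); apply/mem_orthovP => z _.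
by rewrite linearBl /= h subrr.
Qed.

Lemma omegaDl (x y z : a) : omega (x + y) z = omega x z + omega y z.
Proof. exact: linearDl. Qed.
Lemma omegaNl (x z : a) : omega (- x) z = - omega x z.
Proof. exact: linearNl. Qed.
Lemma omegaZl k (x z : a) : omega (k *: x) z = k * omega x z.
Proof. by rewrite linearZl. Qed.
Lemma omega0l (z : a) : omega 0 z = 0.
Proof. exact: linear0l. Qed.
Definition omegaE := (omegaDl, omegaNl, omegaZl, omega0l).

Definition flat (x : a) : dual a := linfun (omega x : a -> K^o).

Lemma flatE x y : flat x y = omega x y.
Proof. by rewrite lfunE. Qed.

Fact flat_is_linear : linear flat.
Proof.
move=> k x y; apply/lfunP => z.
by rewrite add_lfunE scale_lfunE !flatE linearPl.
Qed.
HB.instance Definition _ := GRing.isLinear.Build K a (dual a) _ flat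
  flat_is_linear.

Definition sharp (f : dual a) : a := (linfun flat)^-1%VF f.

Lemma sharpE f x : omega (sharp f) x = f x.
Proof.
have inj : lker (linfun flat) == 0%VS.
  apply/lker0P => u v; rewrite !lfunE => uv; apply: omega_inj => z.
  by rewrite -!flatE uv.
have full : limg (linfun flat) = fullv.
  apply/eqP; rewrite eqEdim subvf limg_dim_eq; last first.
    by rewrite (eqP inj) capv0.
  by rewrite !dimvf /dim /= muln1.
by rewrite -flatE -[flat _]lfunE limg_lfunVK // full memvf.
Qed.

End Musical.

Section Cocycles.
Variables (K : fieldType) (l : lieAlgType K) (a : symplLieAlg K).
Variables (gamma : 'Hom(l, 'Hom(a, dual l))) (eps : 'Hom(l, 'Hom(l, dual l))).
Variable xi : 'Hom(l, 'End(a)).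

(* [sharp] inverts A |-> omega A, so alpha is characterised by [alphaE]. *)
Definition alpha (L1 L2 : l) : a :=
  sharp (linfun (fun A : a => gamma L1 A L2 - gamma L2 A L1 : K^o)).

Definition beta (A1 A2 : a) : dual l :=
  linfun (fun L : l => - omega (xi L A1) A2 - omega A1 (xi L A2) : K^o).

Lemma alphaE L1 L2 A :
  omega (alpha L1 L2) A = gamma L1 A L2 - gamma L2 A L1.
Proof.
rewrite sharpE linfun_linearE // => k x y.
rewrite !linearP !add_lfunE !scale_lfunE.
by rewrite scalerBr opprD addrACA.
Qed.

Lemma betaE A1 A2 L :
  beta A1 A2 L = - omega (xi L A1) A2 - omega A1 (xi L A2).
Proof.
rewrite linfun_linearE // => k x y.
rewrite !linearP !add_lfunE !scale_lfunE linearPl linearPr scale_regE /=.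
by ring.
Qed.

Definition Z2 : Prop :=
  (forall L, eps L L = 0) /\
  [/\ [/\ forall L, lie_derivation (xi L),
          forall L1 L2 A,
            xi L1 (xi L2 A) - xi L2 (xi L1 A) = lie (alpha L1 L2) A
        & forall L1 L2 L3,
            xi L1 (alpha L2 L3) + xi L2 (alpha L3 L1) + xi L3 (alpha L1 L2)
            = 0],
      forall L A1 A2,
        beta (xi L A1) A2 + beta A1 (xi L A2) = gamma L (lie A1 A2),
      forall L1 L2 A,
        gamma L2 (xi L1 A) - gamma L1 (xi L2 A) + beta (alpha L1 L2) A = 0,
      forall L1 L2 L3,
        gamma L1 (alpha L2 L3) + gamma L2 (alpha L3 L1)
        + gamma L3 (alpha L1 L2) = 0
    & forall L1 L2 L3, eps L1 L2 L3 + eps L2 L3 L1 + eps L3 L1 L2 = 0].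

Definition Z2_trivial_lift : Prop :=
  forall L : l,
    (exists A : a,
      [/\ forall B, lie A B + xi L B = 0,
          forall B, gamma L B + beta A B = 0,
          forall L', alpha L L' = xi L' A
        & forall L', eps L L' = gamma L' A]) <->
    L = 0.

Definition Z2_kernel (A : a) : Prop :=
  [/\ A \in lie_center a,
      forall B, beta A B = 0,
      forall L, xi L A = 0
    & forall L, gamma L A = 0].

Definition nondegenerate_on (W : a -> Prop) : Prop :=
  forall A, W A -> (forall B, W B -> omega A B = 0) -> A = 0.

Definition Z2_sharp : Prop :=
  [/\ Z2, Z2_trivial_lift & nondegenerate_on Z2_kernel].

Lemma dual_eq (f g : dual l) : (forall L, f L = g L) -> f = g.
Proof. by move=> h; apply/lfunP. Qed.

Lemma alpha_bilinear : bilinear_for *:%R *:%R alpha.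
Proof.
split=> L k x y; apply: omega_inj => A.
  rewrite linearPl /= !alphaE linearP add_lfunE scale_lfunE !dualE /=.
  by ring.
rewrite linearPl /= !alphaE dualP linearP add_lfunE scale_lfunE !dualE /=.
by ring.
Qed.
HB.instance Definition _ :=
  bilinear_isBilinear.Build K l l a *:%R *:%R alpha alpha_bilinear.

Lemma beta_bilinear : bilinear_for *:%R *:%R beta.
Proof.
split=> A k x y; apply: dual_eq => L; rewrite !dualE !betaE.
  by rewrite (linearP (xi L)) !linearPl /=; ring.
by rewrite (linearP (xi L)) !linearPr /=; ring.
Qed.
HB.instance Definition _ :=
  bilinear_isBilinear.Build K a a (dual l) *:%R *:%R beta beta_bilinear.

Lemma betaC A1 A2 : beta A1 A2 = - beta A2 A1.
Proof.
apply: dual_eq => L; rewrite dualN !betaE [omega A1 _]omegaC.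
by rewrite [omega (xi L A1) _]omegaC; ring.
Qed.

Lemma alphaLL L : alpha L L = 0.
Proof. by apply: omega_inj => A; rewrite alphaE subrr linear0l. Qed.

Lemma betaAA A : beta A A = 0.
Proof.
by apply: dual_eq => L; rewrite betaE dual0 omegaC opprK subrr.
Qed.

Section Extension.
Hypothesis cocycle : Z2.

Lemma beta_lie_cyclic A1 A2 A3 :
  beta A1 (lie A2 A3) + beta A2 (lie A3 A1) + beta A3 (lie A1 A2) = 0.
Proof.
have [_ [[xi_der _ _] _ _ _ _]] := cocycle.
apply: dual_eq => L; rewrite dual0 !dualD !betaE !xi_der !linearDr /=.
have h1 := omega_closed (xi L A1) A2 A3.
have h2 := omega_closed A1 (xi L A2) A3.
have h3 := omega_closed A1 A2 (xi L A3).
have h := congr2 +%R (congr2 +%R h1 h2) h3; rewrite !addr0 in h.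
apply: etrans h.
rewrite ![omega (lie _ _) _]omegaC.
by ring.
Qed.

(* The cocycle hypothesis is recorded in the type, because the Lie algebra
   structure declared on it below requires it. *)
Definition dspace of Z2 : Type := (dual l * a * l)%type.
Notation d := (dspace cocycle).
HB.instance Definition _ := Vector.on d.

Definition dpair (Z : dual l) (A : a) (L : l) : d := (Z, A, L).

Definition d_lie (u v : d) : d :=
  let: (_, A1, L1) := u in let: (_, A2, L2) := v in
  dpair (beta A1 A2 + gamma L1 A2 - gamma L2 A1 + eps L1 L2)
        (lie A1 A2 + xi L1 A2 - xi L2 A1 + alpha L1 L2)
        0.

Definition d_omega (u v : d) : K :=
  let: (Z1, A1, L1) := u in let: (Z2, A2, L2) := v in
  Z1 L2 + omega A1 A2 - Z2 L1.

Lemma dpairP k Z1 A1 L1 Z2 A2 L2 :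
  k *: dpair Z1 A1 L1 + dpair Z2 A2 L2
  = dpair (k *: Z1 + Z2) (k *: A1 + A2) (k *: L1 + L2).
Proof. by []. Qed.
Lemma dpairD Z1 A1 L1 Z2 A2 L2 :
  dpair Z1 A1 L1 + dpair Z2 A2 L2 = dpair (Z1 + Z2) (A1 + A2) (L1 + L2).
Proof. by []. Qed.
Lemma dpair0 : 0 = dpair 0 0 0.
Proof. by []. Qed.

Fact d_lie_bilinear : bilinear_for *:%R *:%R d_lie.
Proof.
split=> - [[Z0 A0] L0] k [[Z1 A1] L1] [[Z2 A2] L2].
  rewrite [d_lie]lock -!/(dpair _ _ _) dpairP -lock /= dpairP.
  congr (_, _, _); last by rewrite scaler0 addr0.
    apply: dual_eq => L; rewrite !linearPl /= !linearP.
    by rewrite /= !(dualE, add_lfunE, scale_lfunE); ring.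
  apply: omega_inj => B; rewrite !linearPl /= !linearP.
  rewrite !(add_lfunE, scale_lfunE).
  by rewrite /= !omegaE; ring.
rewrite [d_lie]lock -!/(dpair _ _ _) dpairP -lock /= dpairP.
congr (_, _, _); last by rewrite scaler0 addr0.
  apply: dual_eq => L; rewrite !linearPr /= !linearP.
  by rewrite /= !(dualE, add_lfunE, scale_lfunE); ring.
apply: omega_inj => B; rewrite !linearPr /= !linearP.
rewrite !(add_lfunE, scale_lfunE).
by rewrite /= !omegaE; ring.
Qed.
HB.instance Definition _ :=
  bilinear_isBilinear.Build K d d d *:%R *:%R d_lie d_lie_bilinear.

Fact d_liexx u : d_lie u u = 0.
Proof.
have [eps_alt _] := cocycle; case: u => [[Z A] L] /=.
rewrite betaAA liexx alphaLL eps_alt !addr0 !add0r !subrr.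
by rewrite dpair0.
Qed.

Fact d_lie_jacobi u v w :
  d_lie u (d_lie v w) + d_lie v (d_lie w u) + d_lie w (d_lie u v) = 0.
Proof.
have [_ [[xi_der xi_comm xi_alpha] gamma_lie gamma_xi gamma_alpha _]] :=
  cocycle.
case: u v w => [[Z1 A1] L1] [[Z2 A2] L2] [[Z3 A3] L3] /=.
rewrite !dpairD dpair0 !(linear0r, linear0, zero_lfunE, addr0, subr0).
congr (dpair _ _ _).
  have bxi L A B : beta A (xi L B) = gamma L (lie A B) + beta B (xi L A).
    by rewrite -gamma_lie [beta (xi L A) B]betaC addrAC addNr add0r.
  have balpha A M N :
      beta A (alpha M N) = gamma N (xi M A) - gamma M (xi N A).
    apply/eqP; rewrite betaC eq_sym -subr_eq0 opprK; apply/eqP.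
    exact: gamma_xi.
  rewrite !linearDr !linearNr /= !balpha !linearD !linearN /=.
  rewrite [beta A2 (xi L1 A3)]bxi [beta A3 (xi L2 A1)]bxi.
  rewrite [beta A1 (xi L3 A2)]bxi.
  apply: dual_eq => L; rewrite !dualE.
  have h := congr2 +%R (beta_lie_cyclic A1 A2 A3) (gamma_alpha L1 L2 L3).
  move/(congr1 (fun f : dual l => f L)): h; rewrite addr0 !dualE => h.
  by apply: etrans h; ring.
rewrite !linearDr !linearNr /= !linearD !linearN /= !xi_der.
have lalpha A M N : lie A (alpha M N) = xi N (xi M A) - xi M (xi N A).
  by rewrite lieC -xi_comm opprB.
rewrite !lalpha.
rewrite [lie (xi _ _) _]lieC [lie (xi L2 A3) _]lieC [lie (xi L3 A1) _]lieC.
apply: omega_inj => B; rewrite !omegaE.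
have h := congr2 +%R (lie_jacobi A1 A2 A3) (xi_alpha L1 L2 L3).
move/(congr1 (fun x : a => omega x B)): h; rewrite addr0 !omegaE => h.
by apply: etrans h; ring.
Qed.
HB.instance Definition _ := isLieAlgebra.Build K d d_liexx d_lie_jacobi.

Fact d_omega_bilinear : bilinear_for *%R (idfun \; *%R) d_omega.
Proof.
split=> - [[Z0 A0] L0] k [[Z1 A1] L1] [[Z2 A2] L2].
  rewrite [d_omega]lock -!/(dpair _ _ _) dpairP -lock /=.
  by rewrite !(dualE, omegaE) /=; ring.
rewrite [d_omega]lock -!/(dpair _ _ _) dpairP -lock /=.
by rewrite linearPr !(dualE, omegaE) /=; ring.
Qed.
HB.instance Definition _ := bilinear_isBilinear.Build K d d K
  *%R (idfun \; *%R) d_omega d_omega_bilinear.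

Fact d_omega_skew u v : d_omega u v = (-1) ^+ true * idfun (d_omega v u).
Proof.
case: u v => [[Z1 A1] L1] [[Z2 A2] L2] /=.
by rewrite [omega A1 A2]omegaC; ring.
Qed.
HB.instance Definition _ := isHermitianSesquilinear.Build K d true idfun
  d_omega d_omega_skew.

Definition d_form : {skew_symmetric d} := d_omega.

Fact d_form_nondegenerate : nondegenerate d_form.
Proof.
rewrite /nondegenerate -subv0; apply/subvP => -[[Z A] L] /mem_orthovP h.
rewrite memv0; apply/eqP; rewrite dpair0; congr (_, _, _).
- apply: dual_eq => M; have := h (dpair 0 0 M) (memvf _).
  by rewrite /= !dual0 linear0r addr0 subr0 => e; apply: e.
- apply: omega_inj => B; have := h (dpair 0 B 0) (memvf _).
  by rewrite /= dual0 linear0 add0r subr0 omega0l.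
apply: (can_inj v2rK); rewrite linear0; apply/rowP => i; rewrite mxE.
have cl : linear (fun M : l => v2r M 0 i : K^o).
  by move=> k x y; rewrite linearP !mxE.
have := h (dpair (linfun (fun M : l => v2r M 0 i : K^o)) 0 0) (memvf _).
rewrite /= linear0 linear0r addr0 sub0r linfun_linearE //.
by move/eqP; rewrite oppr_eq0 => /eqP.
Qed.

Fact d_form_closed (x y z : d) :
  d_form (lie x y) z + d_form (lie y z) x + d_form (lie z x) y = 0.
Proof.
have [eps_alt [_ _ _ _ eps_cyclic]] := cocycle.
case: x y z => [[Z1 A1] L1] [[Z2 A2] L2] [[Z3 A3] L3].
rewrite /d_form /lie /= !linear0 !addr0 !(dualE, omegaE) !alphaE !betaE.
have h := congr2 +%R (omega_closed A1 A2 A3) (eps_cyclic L1 L2 L3).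
rewrite addr0 in h; apply: etrans h.
rewrite [omega A1 (xi _ _)]omegaC [omega A2 (xi _ _)]omegaC.
by rewrite [omega A3 (xi _ _)]omegaC; ring.
Qed.

Lemma d_lieE Z1 A1 L1 Z2 A2 L2 :
  lie (dpair Z1 A1 L1 : d) (dpair Z2 A2 L2)
  = dpair (beta A1 A2 + gamma L1 A2 - gamma L2 A1 + eps L1 L2)
          (lie A1 A2 + xi L1 A2 - xi L2 A1 + alpha L1 L2)
          0.
Proof. by []. Qed.

Lemma d_formE Z1 A1 L1 Z2 A2 L2 :
  d_form (dpair Z1 A1 L1) (dpair Z2 A2 L2)
  = Z1 L2 + omega A1 A2 - Z2 L1.
Proof. by []. Qed.

Definition dual_incl (Z : dual l) : d := dpair Z 0 0.

Fact dual_incl_linear : linear dual_incl.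
Proof.
by move=> k x y; rewrite /dual_incl dpairP !scaler0 !addr0.
Qed.
HB.instance Definition _ := GRing.isLinear.Build K (dual l) d _ dual_incl
  dual_incl_linear.

Definition dual_space : {vspace d} := limg (linfun dual_incl).

Lemma dual_spaceP Z A L :
  reflect (A = 0 /\ L = 0) ((dpair Z A L : d) \in dual_space).
Proof.
have inclE Z' : linfun dual_incl Z' = dual_incl Z' by exact: lfunE.
apply: (iffP idP) => [/memv_imgP[Z' _ e]|[-> ->]].
  by rewrite inclE in e; split; [case: e | case: e].
by apply/memv_imgP; exists Z; [apply: memvf | rewrite inclE].
Qed.

Lemma d_lie_dual (x : d) (Z : dual l) : lie x (dpair Z 0 0 : d) = 0.
Proof.
case: x => [[Z1 A1] L1]; rewrite /lie /= dpair0.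
by rewrite !(linear0r, linear0, zero_lfunE, addr0, subr0).
Qed.

Fact dual_space_ideal (x y : d) :
  y \in dual_space -> lie x y \in dual_space.
Proof.
case: y => [[Z A] L] /dual_spaceP[-> ->].
by rewrite (d_lie_dual x Z) mem0v.
Qed.

Definition d_j : lieIdeal d := LieIdeal dual_space_ideal.

(* The pair (A, L) stands for the class of (Z, A, L) in the quotient by l^*;
   under this identification d_i and d_p are A |-> (A, 0) and (A, L) |-> L. *)
Definition d_i_fun (A : a) : lie_quot d_j := quot_pi d_j (dpair 0 A 0).
Definition d_p_fun (q : lie_quot d_j) : l := (repr q : d).2.

Fact d_i_linear : linear d_i_fun.
Proof.
move=> k A B; rewrite /d_i_fun.
have -> : dpair 0 (k *: A + B) 0 = k *: dpair 0 A 0 + dpair 0 B 0.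
  by rewrite dpairP !scaler0 !addr0.
exact: quot_pi_is_linear.
Qed.
HB.instance Definition _ := GRing.isLinear.Build K a (lie_quot d_j) _ d_i_fun
  d_i_linear.

Lemma d_p_pi (x : d) : d_p_fun (quot_pi d_j x) = (x : d).2.
Proof.
have: repr (quot_pi d_j x) - x \in dual_space by rewrite -quot_piE repr_quotK.
rewrite /d_p_fun; case: (repr _) => [[Z1 A1] L1]; case: x => [[Z2 A2] L2] /=.
by move=> /dual_spaceP[_ /eqP]; rewrite subr_eq0 => /eqP.
Qed.

Fact d_p_linear : linear d_p_fun.
Proof.
by move=> k q r; rewrite -[q]repr_quotK -[r]repr_quotK -linearP !d_p_pi.
Qed.
HB.instance Definition _ := GRing.isLinear.Build K (lie_quot d_j) l _ d_p_fun
  d_p_linear.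

Definition d_i : 'Hom(a, lie_quot d_j) := linfun d_i_fun.
Definition d_p : 'Hom(lie_quot d_j, l) := linfun d_p_fun.

Lemma d_iE A : d_i A = quot_pi d_j (dpair 0 A 0).
Proof. exact: lfunE. Qed.

Lemma d_pE q : d_p q = d_p_fun q.
Proof. exact: lfunE. Qed.

Lemma lie_pi_d_iP Z A L B :
  reflect (A = B /\ L = 0) (lie_pi d_j (dpair Z A L) == d_i B).
Proof.
rewrite lie_piE d_iE quot_piE.
apply: (iffP (dual_spaceP (Z - 0) (A - B) (L - 0))) => -[].
  by rewrite subr0 => /eqP; rewrite subr_eq0 => /eqP.
by move=> -> ->; rewrite !subrr.
Qed.

Hypothesis l_abelian : lie_abelian l.

Fact d_j_central : (d_j <= lie_center d)%VS.
Proof.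
apply/subvP => -[[Z A] L] /dual_spaceP[-> ->]; apply/lie_centerP => y.
by rewrite lieC (d_lie_dual y Z) oppr0.
Qed.

Lemma d_j_orthoP Z A L :
  reflect (L = 0) ((dpair Z A L : d) \in orthov d_form d_j).
Proof.
apply: (iffP mem_orthovP) => [h|->].
  apply: (can_inj v2rK); rewrite linear0; apply/rowP => i; rewrite mxE.
  have cl : linear (fun M : l => v2r M 0 i : K^o).
    by move=> k x y; rewrite linearP !mxE.
  have := h (dpair (linfun (fun M : l => v2r M 0 i : K^o)) 0 0).
  rewrite /d_form /= linear0 linear0r addr0 sub0r linfun_linearE //.
  have e0 : (0 : a) = 0 /\ (0 : l) = 0 by [].
  by move/(_ (introT (dual_spaceP _ _ _) e0))/eqP; rewrite oppr_eq0 => /eqP.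
case=> [[Z' A'] L'] /dual_spaceP[-> ->].
by rewrite /d_form /= !linear0 !addr0.
Qed.

Fact d_j_isotropic : (d_j <= orthov d_form d_j)%VS.
Proof.
by apply/subvP => -[[Z A] L] /dual_spaceP[_ ->]; apply/d_j_orthoP.
Qed.

Fact d_i_morph : lie_morphism d_i.
Proof.
move=> A B; rewrite !lfunE /= [RHS]quot_lieE; apply/eqP.
rewrite quot_piE d_lieE; apply/dual_spaceP.
by rewrite !(linear0, zero_lfunE, linear0r, subr0, addr0) subrr.
Qed.

Fact d_p_morph : lie_morphism d_p.
Proof.
move=> q r; rewrite -[q]repr_quotK -[r]repr_quotK !lfunE /= l_abelian.
rewrite [lie _ _]quot_lieE d_p_pi.
by case: (repr q) (repr r) => [[? ?] ?] [[? ?] ?].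
Qed.

Fact d_i_inj : lker d_i = 0%VS.
Proof.
apply/eqP; rewrite -subv0; apply/subvP => A.
rewrite memv_ker memv0 lfunE /= -(linear0 (quot_pi d_j)) quot_piE subr0.
by case/dual_spaceP => ->.
Qed.

Lemma d_limg_i : limg d_i = (lie_pi d_j @: orthov d_form d_j)%VS.
Proof.
apply/vspaceP => q; apply/memv_imgP/memv_imgP => -[].
  move=> A _ ->; exists (dpair 0 A 0 : d); first exact/d_j_orthoP.
  by rewrite !lfunE.
case=> [[Z A] L] /d_j_orthoP -> ->; exists A; rewrite ?memvf // !lfunE /=.
apply/eqP; rewrite quot_piE; apply/dual_spaceP.
by rewrite subrr subr0.
Qed.

Fact d_exact_mid : limg d_i = lker d_p.
Proof.
rewrite d_limg_i; apply/vspaceP => q; rewrite memv_ker lfunE /=.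
apply/memv_imgP/eqP => [[[[Z A] L] /d_j_orthoP -> ->]|].
  by rewrite lfunE /= d_p_pi.
rewrite -[q]repr_quotK d_p_pi; case: (repr q) => [[Z A] L] /= ->.
by exists (dpair Z A 0 : d); [apply/d_j_orthoP | rewrite lfunE].
Qed.

Fact d_exact_l : limg d_p = fullv.
Proof.
apply/vspaceP => L; rewrite memvf; apply/memv_imgP.
by exists (quot_pi d_j (dpair 0 0 L)); rewrite ?memvf // lfunE /= d_p_pi.
Qed.

Fact d_i_form (A B : a) (x y : d) :
  lie_pi d_j x = d_i A -> lie_pi d_j y = d_i B -> d_form x y = omega A B.
Proof.
case: x => [[Z1 A1] L1] /eqP/lie_pi_d_iP[-> ->].
case: y => [[Z2 A2] L2] /eqP/lie_pi_d_iP[-> ->].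
by rewrite [LHS]d_formE !linear0 add0r addr0.
Qed.

Definition d_alg : symplLieAlg K :=
  SymplLieAlg d_form_nondegenerate d_form_closed.

Definition d_ext : quadExt l a :=
  @QuadExt K l a d_alg d_j d_i d_p l_abelian d_j_central d_j_isotropic d_i_morph d_p_morph d_i_inj
    d_exact_mid d_exact_l d_limg_i d_i_form.

End Extension.
End Cocycles.

(* Main.v *)
(* An element Z + A + L of d is central iff (A, L) satisfies the equations of
   condition (a). The orthogonal of l^* is l^* + a, so l^* is orthogonal to the
   center z iff z is contained in l^* + a, which is condition (a). In that case
   z = l^* + W for the subspace W of condition (b), so the intersection of z
   and z^⊥ is l^* plus the radical of W. *)
Require Import Defs.
From mathcomp Require Import all_boot all_order all_algebra reals.

Set Implicit Arguments.
Unset Strict Implicit.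
Unset Printing Implicit Defensive.

Import GRing.Theory.
Local Open Scope ring_scope.

Section CenterOfExtension.
Variables (K : fieldType) (l : lieAlgType K) (a : symplLieAlg K).
Variables (gamma : 'Hom(l, 'Hom(a, dual l))) (eps : 'Hom(l, 'Hom(l, dual l))).
Variable xi : 'Hom(l, 'End(a)).
Hypothesis cocycle : Z2 gamma eps xi.
Notation d := (d_alg cocycle).

Definition lift_eqs (L : l) (A : a) : Prop :=
  [/\ forall B, lie A B + xi L B = 0,
      forall B, gamma L B + beta xi A B = 0,
      forall L', alpha gamma L L' = xi L' A
    & forall L', eps L L' = gamma L' A].

(** The summand l^* brackets to zero, so [Z] is free. Brackets with elements of a give the first two
    equations of [lift_eqs], brackets with elements of l the last two. *)
Lemma d_centerP Z A L :
  (dpair cocycle Z A L : d) \in lie_center d <-> lift_eqs L A.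
Proof.
split=> [/lie_centerP h|[hlie hbeta hxi hgamma]].
  have ha B : beta xi A B + gamma L B = 0 /\ lie A B + xi L B = 0.
    have := h (dpair cocycle 0 B 0); rewrite [lie _ _]d_lieE dpair0.
    rewrite !(linear0r, linear0, zero_lfunE, addr0, subr0).
    by case=> -> ->.
  have hl M : gamma M A = eps L M /\ xi M A = alpha gamma L M.
    have := h (dpair cocycle 0 0 M); rewrite [lie _ _]d_lieE dpair0.
    rewrite !(linear0r, linear0, zero_lfunE, addr0, add0r).
    case=> /eqP e1 /eqP e2.
    by split; apply/esym/eqP; rewrite -subr_eq0 addrC.
  split=> B; first by case: (ha B).
  - by rewrite addrC; case: (ha B).
  - by case: (hl B).
  by case: (hl B).
apply/lie_centerP => -[[Z' B] M].
rewrite [lie _ _]d_lieE hxi hgamma !subrK hlie.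
by rewrite [beta _ _ _ + _]addrC hbeta.
Qed.

(** Every term linear in L drops out at L = 0. With [d_centerP] this shows that the center meets l^*
    + a in l^* + W. *)
Lemma lift_eqs0 A : lift_eqs 0 A <-> Z2_kernel gamma xi A.
Proof.
split=> -[hlie hbeta hxi hgamma].
  split.
  - by apply/lie_centerP => B; rewrite -[RHS](hlie B) linear0 zero_lfunE addr0.
  - by move=> B; rewrite -[RHS](hbeta B) linear0 zero_lfunE add0r.
  - by move=> L; rewrite -hxi linear0l.
  by move=> L; rewrite -hgamma linear0 zero_lfunE.
split=> B.
- by move/lie_centerP: hlie => ->; rewrite linear0 zero_lfunE addr0.
- by rewrite hbeta linear0 zero_lfunE addr0.
- by rewrite hxi linear0l.
by rewrite hgamma linear0 zero_lfunE.
Qed.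

Lemma d_center_kernelP Z A :
  (dpair cocycle Z A 0 : d) \in lie_center d <-> Z2_kernel gamma xi A.
Proof. by rewrite d_centerP lift_eqs0. Qed.

(** Only one direction of the equivalence in [Z2_trivial_lift] has content: for L = 0 the choice A =
    0 always solves the equations. *)
Lemma Z2_trivial_liftP :
  Z2_trivial_lift gamma eps xi <-> forall L A, lift_eqs L A -> L = 0.
Proof.
split=> [h L A LA|h L]; first by apply/(h L); exists A.
split=> [[A] /h //|->]; exists 0; apply/lift_eqs0; split.
- exact: mem0v.
- by move=> B; rewrite linear0l.
- by move=> L'; rewrite linear0.
by move=> L'; rewrite linear0.
Qed.

Lemma balanced_d_extP (l_abelian : lie_abelian l) :
  balanced (d_ext cocycle l_abelian) <-> Z2_sharp gamma eps xi.
Proof.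
rewrite /balanced /=; split=> [bal | [_ /Z2_trivial_liftP lift0 nondeg]].
  have balE (x : d) : (x \in dual_space cocycle) =
      (x \in (lie_center d :&: orthov omega (lie_center d))%VS).
    by refine (congr1 (fun U : {vspace d} => x \in U) bal).
  (* Balancedness puts l^* inside z^⊥, so the central element 0 + A + L is orthogonal to l^*, which
     forces L = 0. *)
  have lift0 L A : lift_eqs L A -> L = 0.
    move/(d_centerP 0) => zx; apply/(d_j_orthoP cocycle 0 A).
    apply/mem_orthovP => y; rewrite balE.
    move=> /memv_capP[_ /mem_orthovP/(_ _ zx) e].
    by rewrite [LHS](@omegaC K d) [omega _ _]e oppr0.
  split=> //; first exact/Z2_trivial_liftP.
  move=> A WA radA.
  (* A radical vector of W, seen in d, lies in both z and z^⊥; by balancedness it is in l^*, hence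
     zero. *)
  suff /dual_spaceP[] : (dpair cocycle 0 A 0 : d) \in d_j cocycle by [].
  rewrite balE; apply/memv_capP; split; first exact/d_center_kernelP.
  apply/mem_orthovP => -[[Z B] L] zy.
  have L0 := lift0 _ _ (proj1 (d_centerP Z B L) zy); rewrite {}L0 in zy *.
  rewrite [LHS]d_formE !linear0 add0r addr0.
  by apply: radA; apply/d_center_kernelP; exact: zy.
apply/vspaceP => -[[Z A] L]; apply/dual_spaceP/memv_capP => [[-> ->]|[zx ox]].
  split; first by apply: (subvP (d_j_central cocycle)); apply/dual_spaceP.
  (* Central elements have no l-component, the only one that l^* pairs with. *)
  apply/mem_orthovP => -[[Z' B] M] /d_centerP/lift0 ->.
  by rewrite [LHS]d_formE !linear0 linear0l !addr0.
have L0 := lift0 _ _ (proj1 (d_centerP Z A L) zx); rewrite {}L0 in zx ox *.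
split=> //; apply: nondeg; first exact/(d_center_kernelP Z).
(* Each B in W is itself central in d, so orthogonality to z gives [omega A B = 0]. *)
move=> B /(d_center_kernelP 0) zB.
by move/mem_orthovP: ox => /(_ _ zB); rewrite [LHS]d_formE !linear0 add0r addr0.
Qed.

End CenterOfExtension.

Theorem theorem3 (R : realType) (l : lieAlgType R) (a : symplLieAlg R)
    (gamma : 'Hom(l, 'Hom(a, dual l))) (eps : 'Hom(l, 'Hom(l, dual l)))
    (xi : 'Hom(l, 'End(a)))
    (l_abelian : lie_abelian l) (cocycle : Z2 gamma eps xi) :
  balanced (d_ext cocycle l_abelian) <-> Z2_sharp gamma eps xi.
Proof. exact: balanced_d_extP. Qed.
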